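(* Let $G=(V,E)$ be any finite (not necessarily bipartite) graph, let $b:E\to\mathbb{R}_+$ be edge capacities and $q:V\to\mathbb{R}_+$ vertex quotas, and let every vertex $v\in V$ be endowed with the diversifying choice function $C_v$ determined by $q(v)$. Then there exists exactly one stable assignment for $(G,b,q,C)$.
   Context: $\mathbb{R}_+$ denotes the nonnegative reals. Each edge $\{u,v\}\in E$ joins two distinct vertices. No relations between capacities and quotas are imposed. For $v\in V$, $E_v$ is the set of edges incident to $v$. For a real function $f$ on a finite set, $|f|$ denotes the sum of absolute values of $f$ over that set. The symbol $\wedge$ denotes minimum. The set of admissible assignments is $\mathcal{B}=\{x\in\mathbb{R}_+^E : x(e)\le b(e)\ \forall e\in E\}$. For $x\in\mathcal{B}$ and $v\in V$, $x_v$ is the restriction of $x$ to $E_v$, and $\mathcal{B}_v=\{x_v : x\in\mathcal{B}\}$. Diversifying choice function $C_v:\mathcal{B}_v\to\mathcal{B}_v$: for $z\in\mathcal{B}_v$, if $|z|\le q(v)$ then $C_v(z)=z$; if $|z|>q(v)$, take the number $r\ge 0$ with $\sum_{e\in E_v} (r\wedge z(e))=q(v)$ and put $C_v(z)(e)=r\wedge z(e)$ for $e\in E_v$. Rationality: $\mathcal{A}_v=\{z\in\mathcal{B}_v : C_v(z)=z\}$; an assignment $x\in\mathcal{B}$ is rational if $x_v\in\mathcal{A}_v$ for all $v\in V$. Head and upper-bound set: for $z\in\mathcal{A}_v$, if $|z|=q(v)$ ($z$ is fully filling), the head is $H(z)=\{e\in E_v : z(e)=\max_{e'\in E_v}z(e')\}$;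 if $|z|<q(v)$, put $H(z)=\emptyset$. Let $U(z)=\{e\in E_v : z(e)=b(e)\}$. An edge $e\in E_v$ is satiated for $v$ with respect to $z$ if $e\in H(z)\cup U(z)$. Stability: for a rational assignment $x$, an edge $e$ with ends $i,j$ is blocking for $x$ if $e$ is non-satiated both for $i$ with respect to $x_i$ and for $j$ with respect to $x_j$. A rational assignment $x$ is stable if there is no blocking edge for $x$. *)

(* Defs.v *)
From HB Require Import structures.
From mathcomp Require Import all_boot all_order all_algebra.
From mathcomp Require Import boolp classical_sets reals.

Set Implicit Arguments.
Unset Strict Implicit.
Unset Printing Implicit Defensive.

Import Order.TTheory GRing.Theory Num.Theory.
Local Open Scope ring_scope.

(* A graph on V is given by its edge set E, a set of two-element subsets of V
   (the cardinality condition is [is_graph]). *)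
Definition is_graph (V : finType) (E : {set {set V}}) : Prop :=
  forall e : {set V}, e \in E -> #|e| = 2%N.

Notation edge E := {e | e \in E}.

(* E_v, as a subtype of the type of edges. *)
Notation edge_at E v := {e : edge E | v \in sval e}.

Definition absum (R : realType) (T : finType) (f : {ffun T -> R}) : R :=
  \sum_t `|f t|.

Section StableAssignments.
Variables (R : realType) (V : finType) (E : {set {set V}}).
Variables (b : edge E -> R) (q : V -> R).

Definition admissible (x : {ffun edge E -> R}) : Prop :=
  forall e, 0 <= x e /\ x e <= b e.

Definition restr (x : {ffun edge E -> R}) (v : V) :
    {ffun edge_at E v -> R} :=
  [ffun e => x (val e)].

Definition admissible_at (v : V) (z : {ffun edge_at E v -> R}) : Prop :=
  exists2 x, admissible x & restr x v = z.

(* The cutting level r of C_v. The default value 0 of [xget] is never used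
   when z is admissible and q v < absum z, with 0 <= q v: such an r then
   exists and is unique. *)
Definition cut_level (v : V) (z : {ffun edge_at E v -> R}) : R :=
  xget 0 [set r : R | 0 <= r /\ \sum_e Num.min r (z e) = q v]%classic.

Definition choice_fun (v : V) (z : {ffun edge_at E v -> R}) :
    {ffun edge_at E v -> R} :=
  if absum z <= q v then z else [ffun e => Num.min (cut_level z) (z e)].

Definition acceptable (v : V) (z : {ffun edge_at E v -> R}) : Prop :=
  admissible_at z /\ choice_fun z = z.

Definition rational (x : {ffun edge E -> R}) : Prop :=
  admissible x /\ forall v, acceptable (restr x v).

(* The base value 0 of the iterated maximum is harmless since z is
   nonnegative. *)
Definition head_set (v : V) (z : {ffun edge_at E v -> R}) :
    {set edge_at E v} :=
  if absum z == q v then [set e | z e == \big[Num.max/0]_e' z e'] else finset.set0.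

Definition upper_set (v : V) (z : {ffun edge_at E v -> R}) :
    {set edge_at E v} :=
  [set e | z e == b (val e)].

Definition satiated (v : V) (z : {ffun edge_at E v -> R})
    (e : edge_at E v) : bool :=
  e \in head_set z :|: upper_set z.

Definition blocking (x : {ffun edge E -> R}) (e : edge E) : Prop :=
  exists (i j : V) (hi : i \in sval e) (hj : j \in sval e),
    [/\ sval e = [set i; j]%SET,
        ~~ satiated (restr x i) (Sub e hi) &
        ~~ satiated (restr x j) (Sub e hj)].

Definition stable (x : {ffun edge E -> R}) : Prop :=
  rational x /\ forall e, ~ blocking x e.

End StableAssignments.

(* Main.v *)
Require Import Defs.
From HB Require Import structures.
From mathcomp Require Import all_boot all_order all_algebra.
From mathcomp Require Import boolp classical_sets reals.

(** A stable assignment is the same thing as a max-min fair allocation: an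
    assignment within the capacities and quotas in which every edge [e] is
    either filled to its capacity or has a bottleneck, that is, an end [v] whose
    quota is exhausted and at which no edge carries more than [e]
    ([stableP]).  Satiation is exactly this local condition, and rationality
    is exactly respect of the quotas.  Max-min fairness makes sense for any
    incidence relation between edges and vertices, and existence and uniqueness
    are proved at that generality.

    Uniqueness ([max_min_fair_uniq]).  If two fair allocations [x] and [y]
    differ, take an edge [e] where they differ with [min (x e) (y e)] as small
    as possible, say [x e < y e].  Then [e] is below its capacity in [x], so it
    has a bottleneck [v].  As [y] puts more on [e] and the quota of [v] is used
    up by [x], some edge [f] at [v] has [y f < x f <= x e], against the choice
    of [e].

    Existence ([max_min_fair_exists]) is water filling: raise all edges
    uniformly until some edge [e] cannot grow further, because its capacity or
    the quota of one of its ends is reached ([filling_level_exists]).  Fix [e]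
    at that level [r], subtract [r] from the quotas of its ends, and
    recurse on the other edges.  The allocation obtained there never goes below
    [r] ([filling_level_le]), and this makes the bottleneck conditions of the
    smaller problem remain valid once [e] is put back. *)

Set Implicit Arguments.
Unset Strict Implicit.
Unset Printing Implicit Defensive.

Import Order.TTheory GRing.Theory Num.Theory.
Local Open Scope ring_scope.

(** * Max-min fair allocations *)

Section MaxMinFair.
Variables (R : realFieldType) (V T : finType) (inc : T -> pred V).
Implicit Types (S : {set T}) (x y b : T -> R) (q : V -> R).

Definition load S x v : R := \sum_(e in S | inc e v) x e.

Definition bottleneck q S x e v : Prop :=
  [/\ inc e v, load S x v = q v &
      forall f, f \in S -> inc f v -> x f <= x e].

Definition max_min_fair b q S x : Prop :=
  [/\ forall e, e \in S -> 0 <= x e <= b e,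
      forall v, load S x v <= q v &
      forall e, e \in S -> x e = b e \/ exists v, bottleneck q S x e v].

(** A common level to which all edges of [S] can be raised at once. *)
Definition filling_level b q S (r : R) : Prop :=
  (forall e, e \in S -> r <= b e) /\ (forall v, load S (fun=> r) v <= q v).

Lemma load_lt S x y e v :
    (forall f, f \in S -> inc f v -> x f <= y f) ->
    e \in S -> inc e v -> x e < y e ->
  load S x v < load S y v.
Proof.
move=> lexy eS ev ltxy; rewrite /load (bigD1 e) ?eS //= [ltRHS](bigD1 e) ?eS //=.
apply: ltr_leD => //; apply: ler_sum => f /andP[/andP[fS fv] _].
exact: lexy.
Qed.

Lemma load_const S r v : load S (fun=> r) v = r * load S (fun=> 1) v.
Proof. by rewrite /load mulr_sumr; apply: eq_bigr => e _; rewrite mulr1. Qed.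

Lemma load_setD1 S x e v : e \in S ->
  load S x v = (if inc e v then x e else 0) + load (S :\ e) x v.
Proof.
by move=> eS; rewrite /load !big_mkcondr (big_setD1 e).
Qed.

Lemma eq_load S x y v : {in S, x =1 y} -> load S x v = load S y v.
Proof. by move=> xy; apply: eq_bigr => e /andP[/xy]. Qed.

(** A vertex that is a bottleneck for [e] in the allocation giving [e] less
    yields an edge of strictly smaller common value where the two allocations
    again differ, so a minimal disagreement cannot exist. *)
Lemma max_min_fair_uniq b q S x y :
  max_min_fair b q S x -> max_min_fair b q S y -> {in S, x =1 y}.
Proof.
move=> fx fy e0 e0S; apply/eqP/negPn/negP => ne0.
pose D := [pred e | (e \in S) && (x e != y e)].
have De0 : D e0 by rewrite /= e0S.
case: (arg_minP (fun e => Num.min (x e) (y e)) De0) => e /andP[eS ne] emin.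
have smaller_diff z t : max_min_fair b q S z -> max_min_fair b q S t ->
    z e < t e -> exists2 f, f \in S & t f < z f /\ t f < z e.
  case=> _ _ neckz [boundt loadt _] ltzt.
  case: (neckz e eS) => [eb | [v [ev full maxe]]].
    have /andP[_ tb] := boundt e eS.
    by move: ltzt; rewrite eb ltNge tb.
  have [/exists_inP[f fS /andP[fv ltf]] | none] :=
      boolP [exists f in S, inc f v && (t f < z f)].
    by exists f => //; split=> //; apply: lt_le_trans ltf (maxe f fS fv).
  have: load S z v < load S t v.
    apply: (@load_lt _ _ _ e) => // f fS fv; rewrite leNgt.
    apply: contra none => ltf; apply/exists_inP; exists f => //.
    by rewrite fv.
  by rewrite full ltNge loadt.
have [ltxy | ltyx | /eqP] := ltgtP (x e) (y e); last by rewrite (negPf ne).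
- have [f fS [ltf ltfe]] := smaller_diff x y fx fy ltxy.
  have /emin : D f by rewrite /= fS gt_eqF.
  by rewrite (min_idPl (ltW ltxy)) (min_idPr (ltW ltf)) leNgt ltfe.
- have [f fS [ltf ltfe]] := smaller_diff y x fy fx ltyx.
  have /emin : D f by rewrite /= fS lt_eqF.
  by rewrite (min_idPr (ltW ltyx)) (min_idPl (ltW ltf)) leNgt ltfe.
Qed.

(** An edge below [r] would have a bottleneck all of whose edges are below
    [r], whereas the quota there has room for [r] on every edge. *)
Lemma filling_level_le b q S x r : max_min_fair b q S x ->
  filling_level b q S r -> forall e, e \in S -> r <= x e.
Proof.
case=> _ _ neck [rb rq] e eS.
case: (neck e eS) => [-> | [v [ev full maxe]]]; first exact: rb.
rewrite leNgt; apply/negP => lter.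
have: load S x v < load S (fun=> r) v.
  apply: (@load_lt _ _ _ e) => // f fS fv.
  exact: le_trans (maxe f fS fv) (ltW lter).
by rewrite full ltNge rq.
Qed.

(** The level is the least among the capacities of the edges and the fair
    shares, quota divided by degree, of the vertices meeting [S]; the pair
    [(e, None)] stands for the capacity of [e] and [(e, Some v)] for the share
    of [e] at [v]. *)
Lemma filling_level_exists b q S e1 :
    (forall e, 0 <= b e) -> (forall v, 0 <= q v) -> e1 \in S ->
  exists e r, [/\ e \in S, 0 <= r, filling_level b q S r &
    r = b e \/ exists2 v, inc e v & load S (fun=> r) v = q v].
Proof.
move=> b0 q0 e1S; pose d := load S (fun=> 1).
pose P := [pred c : T * option V | (c.1 \in S) &&
  (if c.2 is Some v then inc c.1 v else true)].
pose F (c : T * option V) := if c.2 is Some v then q v / d v else b c.1.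
have d_gt0 f v : f \in S -> inc f v -> 0 < d v.
  move=> fS fv; have -> : 0 = load S (fun=> 0) v by rewrite /load big1.
  exact: (@load_lt _ _ _ f).
have P1 : P (e1, None) by rewrite /= e1S.
case: (arg_minP F P1) => [[e o]] /andP[/= eS eo] minF.
exists e, (F (e, o)); split=> //.
- case: o eo {minF} => [v ev|_]; last exact: b0.
  by rewrite /F /= divr_ge0 // ltW // (d_gt0 e).
- split=> [f fS | v]; first by apply: (minF (f, None)); rewrite /= fS.
  rewrite load_const -/(d v).
  have [/exists_inP[f fS fv] | none] := boolP [exists f in S, inc f v].
    rewrite -ler_pdivlMr ?(d_gt0 f) //.
    by apply: (minF (f, Some v)); rewrite /= fS.
  rewrite /d /load big_pred0 ?mulr0 // => f.
  by apply: contraNF none => /andP[fS fv]; apply/exists_inP; exists f.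
- case: o eo {minF} => [v ev|_]; [right; exists v => // | by left].
  by rewrite load_const /F /= divfK // gt_eqF // (d_gt0 e).
Qed.

(** Water filling, one edge at a time.  The bottlenecks of the other edges
    survive the return of [e] because [e] sits at the common lower bound [r];
    a bottleneck for [e] itself appears because lower bound [r] and exhausted
    quota force every edge at that vertex to equal [r]. *)
Lemma max_min_fair_exists b q S :
    (forall e, 0 <= b e) -> (forall v, 0 <= q v) ->
  exists x, max_min_fair b q S x.
Proof.
move=> b0; have [n] := ubnP #|S|; elim: n => // n IHn in S q * => cardS q0.
have [-> | [e1 e1S]] := set_0Vmem S.
  exists (fun=> 0); split=> [e | v | e]; rewrite ?inE //.
  by rewrite /load big1.
have [e [r [eS r0 [rb rq] tight]]] := filling_level_exists b0 q0 e1S.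
pose S' := S :\ e; pose q' v := q v - (if inc e v then r else 0).
have rq' v : load S' (fun=> r) v <= q' v.
  by rewrite /q' lerBrDl -(load_setD1 (fun=> r)).
have [||x' fair'] := IHn S' q'.
- by rewrite -ltnS (leq_trans _ cardS) // ltnS (cardsD1 e S) eS.
- by move=> v; apply: le_trans (rq' v); apply: sumr_ge0.
have r_le : forall f, f \in S' -> r <= x' f.
  by apply: (filling_level_le fair'); split=> // f /setD1P[_ /rb].
case: fair' => bound' load' neck'.
pose x f := if f == e then r else x' f.
have xe : x e = r by rewrite /x eqxx.
have xx' : {in S', x =1 x'} by move=> f /setD1P[/negPf nfe _]; rewrite /x nfe.
have inS' f : f \in S -> f != e -> f \in S' by move=> fS nfe; apply/setD1P.
have r_le_x f : f \in S -> r <= x f.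
  move=> fS; have [-> | nfe] := eqVneq f e; first by rewrite xe.
  by rewrite xx' ?r_le // inS'.
have loadE v : load S x v = (if inc e v then r else 0) + load S' x' v.
  by rewrite (load_setD1 _ _ eS) xe (eq_load _ xx').
have load_le v : load S x v <= q v by rewrite loadE -lerBrDl load'.
exists x; split=> // f fS; have [-> | nfe] := eqVneq f e.
- by rewrite xe r0 rb.
- by rewrite xx' ?bound' // inS'.
- case: tight => [rbe | [v ev full]]; [by left; rewrite xe | right; exists v].
  (* All edges at [v] are at least [r] and the quota only allows [r] on each. *)
  split=> // [|g gS gv].
    apply/eqP; rewrite eq_le load_le -full.
    by apply: ler_sum => g /andP[gS _]; apply: r_le_x.
  rewrite xe leNgt; apply/negP => ltrg.
  have: load S (fun=> r) v < load S x v.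
    by apply: (@load_lt _ _ _ g) => // h hS _; apply: r_le_x.
  by rewrite full ltNge load_le.
- have fS' := inS' f fS nfe; rewrite (xx' f fS').
  case: (neck' f fS') => [|[v [fv full maxf]]]; [by left | right; exists v].
  split=> // [|g gS gv]; first by rewrite loadE full addrC subrK.
  rewrite (xx' f fS'); have [-> | nge] := eqVneq g e; first by rewrite xe r_le.
  by rewrite xx' ?maxf // inS'.
Qed.

End MaxMinFair.

(** * Stability as max-min fairness *)

Section StableFair.
Variables (R : realType) (V : finType) (E : {set {set V}}).
Variables (b : edge E -> R) (q : V -> R).
Implicit Types (x : {ffun edge E -> R}).

Let ends (e : edge E) : pred V := fun v => v \in sval e.

Lemma absum_restr x v : admissible b x ->
  absum (restr x v) = load ends [set: edge E] x v.
Proof.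
move=> adm; rewrite /absum /load.
rewrite [RHS](eq_bigl [in [pred e | ends e v]]) => [|e]; last by rewrite !inE.
rewrite [RHS]big_sub.
by apply: eq_bigr => t _; rewrite ffunE ger0_norm //; case: (adm (\val t)).
Qed.

(** Were [z] above its quota, a cutting level fixing it would sum to both
    [absum z] and [q v].  If no cutting level exists, [cut_level] is [0], which
    can only fix the zero assignment. *)
Lemma choice_fun_fixed v (z : {ffun edge_at E v -> R}) :
    (forall t, 0 <= z t) -> 0 <= q v ->
  choice_fun q z = z <-> absum z <= q v.
Proof.
move=> z0 q0; rewrite /choice_fun; case: ifP => [_ // | /negP nle].
split=> // /ffunP fix_z; case: nle.
have fixE t : Num.min (cut_level q z) (z t) = z t.
  by have := fix_z t; rewrite ffunE.
have absE : absum z = \sum_t Num.min (cut_level q z) (z t).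
  by apply: eq_bigr => t _; rewrite fixE ger0_norm.
move: absE; rewrite /cut_level; case: xgetP => [r _ [_ ->] -> // | _ ->].
by rewrite big1 // => t _; apply/min_idPl.
Qed.

Lemma rationalP x : (forall v, 0 <= q v) ->
  Defs.rational b q x <->
  admissible b x /\ forall v, load ends [set: edge E] x v <= q v.
Proof.
move=> q0; split=> -[adm rat]; split=> // v; have z0 t : 0 <= restr x v t.
- by rewrite ffunE; case: (adm (val t)).
- by case: (rat v) => _ /choice_fun_fixed; rewrite (absum_restr _ adm); apply.
- by rewrite ffunE; case: (adm (val t)).
- by split; [exists x | apply/choice_fun_fixed; rewrite // (absum_restr _ adm)].
Qed.

(** The head is taken at a quota-filling vertex and consists of the maximal
    edges there, which is what a bottleneck is. *)
Lemma satiatedP x v (t : edge_at E v) : admissible b x ->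
  satiated b q (restr x v) t <->
  x (val t) = b (val t) \/ bottleneck ends q [set: edge E] x (val t) v.
Proof.
move=> adm; rewrite /satiated /head_set /upper_set (absum_restr _ adm).
have maxE : (restr x v t == \big[Num.max/0]_t' restr x v t') <->
    (forall f, ends f v -> x f <= x (val t)).
  split=> [/eqP tmax f fv | tmax].
    have := le_bigmax 0 (restr x v) (Sub f fv).
    by rewrite -tmax !ffunE SubK.
  rewrite eq_le le_bigmax bigmax_le // ?ffunE; first by case: (adm (val t)).
  by move=> t' _; rewrite ffunE; exact: tmax (valP t').
rewrite finset.in_setU [t \in [set _ | _]]inE ffunE.
case: eqP => [full | nfull].
  rewrite inE; split=> [/orP[/maxE tmax | /eqP] | [/eqP -> | [_ _ tmax]]].
  - by right; split=> //; [exact: (valP t) | move=> f _; exact: tmax].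
  - by left.
  - exact: orbT.
  - by apply/orP; left; apply/maxE => f; apply: tmax; rewrite finset.in_setT.
rewrite finset.in_set0 /=.
by split=> [/eqP | [/eqP // | [_ /nfull]]]; first by left.
Qed.

Lemma stableP x : is_graph E -> (forall v, 0 <= q v) ->
  stable b q x <-> max_min_fair ends b q [set: edge E] x.
Proof.
move=> gE q0; split=> [[/(rationalP _ q0)[adm rat] noblock] | ].
  split=> // e _; first by case: (adm e) => -> ->.
  have /eqP/cards2P[i [j [_ ije]]] := gE _ (svalP e).
  have hi : i \in sval e by rewrite ije !inE eqxx.
  have hj : j \in sval e by rewrite ije !inE eqxx orbT.
  have [/(satiatedP _ adm)[]|nsi] := boolP (satiated b q (restr x i) (Sub e hi)).
  - by left.
  - by right; exists i.
  have [/(satiatedP _ adm)[]|nsj] := boolP (satiated b q (restr x j) (Sub e hj)).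
  - by left.
  - by right; exists j.
  by case: (noblock e); exists i, j, hi, hj.
case=> bound loadq neck.
have adm : admissible b x.
  by move=> e; apply/andP; apply: bound; rewrite finset.in_setT.
split; first exact/(rationalP _ q0).
move=> e [i [j [hi [hj [ije /negP nsi /negP nsj]]]]].
have [|eb | [v neckv]] := neck e; first by rewrite finset.in_setT.
  by apply: nsi; apply/(satiatedP _ adm); left.
have: v \in sval e by case: neckv.
rewrite ije => /set2P[] vE; rewrite {}vE in neckv.
- by apply: nsi; apply/(satiatedP _ adm); right.
- by apply: nsj; apply/(satiatedP _ adm); right.
Qed.

End StableFair.

Theorem corollary5p1 (R : realType) (V : finType) (E : {set {set V}})
    (b : edge E -> R) (q : V -> R)
    (hE : is_graph E)
    (hb : forall e, 0 <= b e) (hq : forall v, 0 <= q v) :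
  exists! x : {ffun edge E -> R}, stable b q x.
Proof.
have [x fair_x] := max_min_fair_exists (fun (e : edge E) v => v \in sval e)
  [set: edge E] hb hq.
exists (finfun x); split.
  apply/(stableP _ _ hE hq).
  by have -> : (finfun x : edge E -> R) = x by apply/funext => e; rewrite ffunE.
move=> y /(stableP _ _ hE hq) fair_y; apply/ffunP => e; rewrite ffunE.
by apply: (max_min_fair_uniq fair_x fair_y); rewrite finset.in_setT.
Qed.
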